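(* Let $\mathbb{H}=(H_1,H_2)$ be a Hopf brace in a strict braided monoidal category $\mathsf{C}$. Then the category ${}_{(id_H,\Gamma_{H_1})}\mathsf{Mod}$ of left modules over the invertible 1-cocycle $id_H:H_2\to H_1$ with action $\Gamma_{H_1}$ and the category ${}_{\mathbb{H}}\mathsf{Mod}$ of left $\mathbb{H}$-modules are equivalent.
   Context: $\mathsf{C}$ is a strict braided monoidal category with tensor product $\otimes$, unit object $K$ and braiding $c$. For an object $P$ and a morphism $f$, one writes $P\otimes f$ for $id_P\otimes f$ and $f\otimes P$ for $f\otimes id_P$. A Hopf algebra $H$ in $\mathsf{C}$ has unit $\eta_H$, product $\mu_H$, counit $\varepsilon_H$, coproduct $\delta_H$ and antipode $\lambda_H$ (the convolution inverse of $id_H$), where the tensor product of algebras (coalgebras) is an algebra (coalgebra) via the braiding $c$. Left modules over an algebra and their morphisms are the usual ones. Hopf brace: let $(H,\varepsilon_H,\delta_H)$ be a coalgebra with two algebra structures $(H,\eta_H^1,\mu_H^1)$, $(H,\eta_H^2,\mu_H^2)$ and endomorphisms $\lambda_H^1,\lambda_H^2$ of $H$. These data form a Hopf brace $\mathbb{H}=(H_1,H_2)$ if $H_i=(H,\eta_H^i,\mu_H^i,\varepsilon_H,\delta_H,\lambda_H^i)$ is a Hopf algebra in $\mathsf{C}$ for $i=1,2$ and $$\mu_H^2\circ(H\otimes\mu_H^1)=\mu_H^1\circ(\mu_H^2\otimes\Gamma_{H_1})\circ(H\otimes c_{H,H}\otimes H)\circ(\delta_H\otimes H\otimes H),$$ where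 $\Gamma_{H_1}=\mu_H^1\circ(\lambda_H^1\otimes\mu_H^2)\circ(\delta_H\otimes H)$. Left $\mathbb{H}$-module: a triple $(M,\psi_M^1,\psi_M^2)$ where $(M,\psi_M^1)$ is a left $H_1$-module, $(M,\psi_M^2)$ is a left $H_2$-module and $$\psi_M^2\circ(H\otimes\psi_M^1)=\psi_M^1\circ(\mu_H^2\otimes\Gamma_M)\circ(H\otimes c_{H,H}\otimes M)\circ(\delta_H\otimes H\otimes M),$$ where $\Gamma_M=\psi_M^1\circ(\lambda_H^1\otimes\psi_M^2)\circ(\delta_H\otimes M)$. Morphisms of left $\mathbb{H}$-modules are morphisms in $\mathsf{C}$ that are morphisms of left $H_1$-modules and of left $H_2$-modules; the resulting category is ${}_{\mathbb{H}}\mathsf{Mod}$. Module algebra: for a Hopf algebra $D$, an algebra $B$ is a left $D$-module algebra with action $\phi_B:D\otimes B\to B$ if $(B,\phi_B)$ is a left $D$-module, $\phi_B\circ(D\otimes\eta_B)=\varepsilon_D\otimes\eta_B$ and $\phi_B\circ(D\otimes\mu_B)=\mu_B\circ(\phi_B\otimes\phi_B)\circ(D\otimes c_{D,B}\otimes B)\circ(\delta_D\otimes B\otimes B)$. Invertible 1-cocycle: let $A,H$ be Hopf algebras in $\mathsf{C}$ such that $H$ is a left $A$-module algebra with action $\phi_H$. A coalgebra morphism $\pi:A\to H$ is an invertible 1-cocycle (with action $\phi_H$) if it is an isomorphism and $\pi\circ\mu_A=\mu_H\circ(\pi\otimes\phi_H)\circ(\delta_A\otimes\pi)$. For a Hopf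 brace $\mathbb{H}$, it is known that $(H,\eta_H^1,\mu_H^1)$ is a left $H_2$-module algebra with action $\Gamma_{H_1}$ and that $id_H:H_2\to H_1$ is an invertible 1-cocycle with this action. A left module over an invertible 1-cocycle $\pi:A\to H$ with action $\phi_H$ is a 6-tuple $(M,N,\phi_M,\varphi_M,\phi_N,\gamma)$ where: (i) $(M,\phi_M)$ is a left $A$-module, $(M,\varphi_M)$ is a left $H$-module and $\phi_M\circ(A\otimes\varphi_M)=\varphi_M\circ(\phi_H\otimes\phi_M)\circ(A\otimes c_{A,H}\otimes M)\circ(\delta_A\otimes H\otimes M)$; (ii) $(N,\phi_N)$ is a left $A$-module; (iii) $\gamma:N\to M$ is an isomorphism in $\mathsf{C}$ with $\gamma\circ\phi_N=\varphi_M\circ(\pi\otimes\phi_M)\circ(\delta_A\otimes\gamma)$. A morphism $(M,N,\phi_M,\varphi_M,\phi_N,\gamma)\to(M',N',\phi_{M'},\varphi_{M'},\phi_{N'},\gamma')$ is a pair $(h,l)$ with $h:M\to M'$ a morphism of left $A$-modules and of left $H$-modules, $l:N\to N'$ a morphism of left $A$-modules and $h\circ\gamma=\gamma'\circ l$. These form the category ${}_{(\pi,\phi_H)}\mathsf{Mod}$. *)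

(* Defs.v *)
From Stdlib Require Import ProofIrrelevance ClassicalEpsilon Eqdep List.
Import ListNotations.

Set Implicit Arguments.
Unset Strict Implicit.
Unset Printing Implicit Defensive.

Declare Scope cat_scope.
Delimit Scope cat_scope with cat.
Open Scope cat_scope.

Record category := Category {
  ob :> Type;
  hom : ob -> ob -> Type;
  idm : forall A, hom A A;
  comp : forall A B D, hom B D -> hom A B -> hom A D;
  comp_idl : forall A B (f : hom A B), comp (idm B) f = f;
  comp_idr : forall A B (f : hom A B), comp f (idm A) = f;
  comp_assoc : forall A B D E (h : hom D E) (g : hom B D) (f : hom A B),
    comp h (comp g f) = comp (comp h g) f
}.
Arguments hom {c} _ _.
Arguments idm {c} A.
Arguments comp {c A B D} _ _.

Notation "g ∘ f" := (comp g f) (at level 40, left associativity) : cat_scope.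

Definition is_iso (C : category) (A B : C) (f : hom A B) : Prop :=
  exists g : hom B A, g ∘ f = idm A /\ f ∘ g = idm B.

Record functor (C D : category) := Functor {
  fob :> C -> D;
  fhom : forall A B : C, hom A B -> hom (fob A) (fob B);
  fhom_id : forall A : C, fhom (idm A) = idm (fob A);
  fhom_comp : forall (A B E : C) (g : hom B E) (f : hom A B),
    fhom (g ∘ f) = fhom g ∘ fhom f
}.
Arguments fhom {C D} f0 {A B} _.

Definition functor_id (C : category) : functor C C :=
  @Functor C C (fun A => A) (fun A B f => f)
    (fun A => eq_refl) (fun A B E g f => eq_refl).

Definition functor_comp (C D E : category) (G : functor D E) (F : functor C D) :
  functor C E.
Proof.
refine (@Functor C E (fun A => G (F A)) (fun A B f => fhom G (fhom F f)) _ _).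
- intros A; now rewrite !fhom_id.
- intros A B X g f; now rewrite !fhom_comp.
Defined.

Definition nat_isomorphic (C D : category) (F G : functor C D) : Prop :=
  exists t : forall A : C, hom (F A) (G A),
    (forall A, is_iso (t A)) /\
    (forall (A B : C) (f : hom A B), t B ∘ fhom F f = fhom G f ∘ t A).

Definition equivalent (C D : category) : Prop :=
  exists (F : functor C D) (G : functor D C),
    nat_isomorphic (functor_comp G F) (functor_id C) /\
    nat_isomorphic (functor_comp F G) (functor_id D).

(** The identity of [A], seen as a morphism between two equal objects.
    Strictness of a monoidal category is an equality of objects, which is not
    a conversion here; [idto] is the identity that the strict notation leaves
    implicit. *)
Definition idto (C : category) (A B : C) (e : A = B) : hom A B :=
  match e in _ = X return hom A X with eq_refl => idm A end.

Record strict_monoidal := StrictMonoidal {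
  smcat :> category;
  tens : smcat -> smcat -> smcat;
  tensm : forall A B A' B' : smcat,
    hom A B -> hom A' B' -> hom (tens A A') (tens B B');
  unit_ob : smcat;
  tensm_id : forall A B, tensm (idm A) (idm B) = idm (tens A B);
  tensm_comp : forall (A B D A' B' D' : smcat)
      (g : hom B D) (f : hom A B) (g' : hom B' D') (f' : hom A' B'),
    tensm (g ∘ f) (g' ∘ f') = tensm g g' ∘ tensm f f';
  tens_assoc : forall A B D, tens (tens A B) D = tens A (tens B D);
  tens_unitl : forall A, tens unit_ob A = A;
  tens_unitr : forall A, tens A unit_ob = A;
  tensm_assoc : forall (A A' B B' D D' : smcat)
      (f : hom A A') (g : hom B B') (h : hom D D'),
    idto (tens_assoc A' B' D') ∘ tensm (tensm f g) h =
    tensm f (tensm g h) ∘ idto (tens_assoc A B D);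
  tensm_unitl : forall (A B : smcat) (f : hom A B),
    idto (tens_unitl B) ∘ tensm (idm unit_ob) f = f ∘ idto (tens_unitl A);
  tensm_unitr : forall (A B : smcat) (f : hom A B),
    idto (tens_unitr B) ∘ tensm f (idm unit_ob) = f ∘ idto (tens_unitr A)
}.
Arguments tens {s} _ _.
Arguments tensm {s A B A' B'} _ _.
Arguments unit_ob {s}.

Notation "A ⊗ B" := (tens A B) (at level 35, right associativity) : cat_scope.
Notation "f ⊠ g" := (tensm f g) (at level 35, right associativity) : cat_scope.
Notation K := unit_ob (only parsing).

Definition asc (C : strict_monoidal) (A B D : C) :
  hom ((A ⊗ B) ⊗ D) (A ⊗ (B ⊗ D)) := idto (tens_assoc A B D).
Definition asci (C : strict_monoidal) (A B D : C) :
  hom (A ⊗ (B ⊗ D)) ((A ⊗ B) ⊗ D) := idto (eq_sym (tens_assoc A B D)).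
Definition lun (C : strict_monoidal) (A : C) : hom (K ⊗ A) A :=
  idto (tens_unitl A).
Definition run (C : strict_monoidal) (A : C) : hom (A ⊗ K) A :=
  idto (tens_unitr A).
Definition unit_dup (C : strict_monoidal) : hom (K : C) (K ⊗ K) :=
  idto (eq_sym (tens_unitl K)).
Arguments asc {C} A B D.
Arguments asci {C} A B D.
Arguments lun {C} A.
Arguments run {C} A.
Arguments unit_dup {C}.

Record strict_braided := StrictBraided {
  sbcat :> strict_monoidal;
  braid : forall A B : sbcat, hom (A ⊗ B) (B ⊗ A);
  braid_iso : forall A B, is_iso (braid A B);
  braid_nat : forall (A A' B B' : sbcat) (f : hom A A') (g : hom B B'),
    braid A' B' ∘ (f ⊠ g) = (g ⊠ f) ∘ braid A B;
  braid_tensr : forall A B D : sbcat,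
    braid A (B ⊗ D) =
    asci B D A ∘ (idm B ⊠ braid A D) ∘ asc B A D ∘ (braid A B ⊠ idm D)
      ∘ asci A B D;
  braid_tensl : forall A B D : sbcat,
    braid (A ⊗ B) D =
    asc D A B ∘ (braid A D ⊠ idm B) ∘ asci A D B ∘ (idm A ⊠ braid B D)
      ∘ asc A B D
}.

Section Structures.
Variable C : strict_braided.
Implicit Types A B D E H M N : C.

(** [A ⊗ c_{B,D} ⊗ E] *)
Definition mid A B D E : hom ((A ⊗ B) ⊗ (D ⊗ E)) ((A ⊗ D) ⊗ (B ⊗ E)) :=
  asci A D (B ⊗ E) ∘ (idm A ⊠ asc D B E) ∘ (idm A ⊠ (braid B D ⊠ idm E))
    ∘ (idm A ⊠ asci B D E) ∘ asc A B (D ⊗ E).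

Definition is_algebra A (eta : hom K A) (mu : hom (A ⊗ A) A) : Prop :=
  mu ∘ (eta ⊠ idm A) = lun A /\
  mu ∘ (idm A ⊠ eta) = run A /\
  mu ∘ (mu ⊠ idm A) = mu ∘ (idm A ⊠ mu) ∘ asc A A A.

Definition is_coalgebra A (eps : hom A K) (delta : hom A (A ⊗ A)) : Prop :=
  lun A ∘ (eps ⊠ idm A) ∘ delta = idm A /\
  run A ∘ (idm A ⊠ eps) ∘ delta = idm A /\
  asc A A A ∘ (delta ⊠ idm A) ∘ delta = (idm A ⊠ delta) ∘ delta.

Definition is_alg_morph A B (etaA : hom K A) (muA : hom (A ⊗ A) A)
    (etaB : hom K B) (muB : hom (B ⊗ B) B) (f : hom A B) : Prop :=
  f ∘ etaA = etaB /\ f ∘ muA = muB ∘ (f ⊠ f).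

Definition is_coalg_morph A B (epsA : hom A K) (deltaA : hom A (A ⊗ A))
    (epsB : hom B K) (deltaB : hom B (B ⊗ B)) (f : hom A B) : Prop :=
  epsB ∘ f = epsA /\ deltaB ∘ f = (f ⊠ f) ∘ deltaA.

Definition tens_eta A B (etaA : hom K A) (etaB : hom K B) : hom K (A ⊗ B) :=
  (etaA ⊠ etaB) ∘ unit_dup.

Definition tens_mu A B (muA : hom (A ⊗ A) A) (muB : hom (B ⊗ B) B) :
  hom ((A ⊗ B) ⊗ (A ⊗ B)) (A ⊗ B) :=
  (muA ⊠ muB) ∘ mid A B A B.

Definition convolution A B (delta : hom A (A ⊗ A)) (mu : hom (B ⊗ B) B)
    (f g : hom A B) : hom A B :=
  mu ∘ (f ⊠ g) ∘ delta.

Definition is_hopf H (eta : hom K H) (mu : hom (H ⊗ H) H) (eps : hom H K)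
    (delta : hom H (H ⊗ H)) (lambda : hom H H) : Prop :=
  is_algebra eta mu /\
  is_coalgebra eps delta /\
  is_alg_morph eta mu (idm K) (lun K) eps /\
  is_alg_morph eta mu (tens_eta eta eta) (tens_mu mu mu) delta /\
  convolution delta mu lambda (idm H) = eta ∘ eps /\
  convolution delta mu (idm H) lambda = eta ∘ eps.

Record hopf_algebra := HopfAlgebra {
  hcar :> C;
  heta : hom K hcar;
  hmu : hom (hcar ⊗ hcar) hcar;
  heps : hom hcar K;
  hdelta : hom hcar (hcar ⊗ hcar);
  hlambda : hom hcar hcar;
  hopfP : is_hopf heta hmu heps hdelta hlambda
}.

Definition is_module H (eta : hom K H) (mu : hom (H ⊗ H) H)
    M (psi : hom (H ⊗ M) M) : Prop :=
  psi ∘ (eta ⊠ idm M) = lun M /\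
  psi ∘ (mu ⊠ idm M) = psi ∘ (idm H ⊠ psi) ∘ asc H H M.

Definition is_module_morph H M M' (psi : hom (H ⊗ M) M) (psi' : hom (H ⊗ M') M')
    (f : hom M M') : Prop :=
  f ∘ psi = psi' ∘ (idm H ⊠ f).

Definition is_module_algebra (D : hopf_algebra) B (eta : hom K B)
    (mu : hom (B ⊗ B) B) (phi : hom (D ⊗ B) B) : Prop :=
  is_module (heta D) (hmu D) phi /\
  phi ∘ (idm (hcar D) ⊠ eta) = lun B ∘ (heps D ⊠ eta) /\
  phi ∘ (idm (hcar D) ⊠ mu) =
    mu ∘ (phi ⊠ phi) ∘ mid D D B B ∘ (hdelta D ⊠ idm (B ⊗ B)).

(** [Γ_M]; for [M = H], [psi1 = μ¹] and [psi2 = μ²] this is [Γ_{H₁}]. *)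
Definition Gamma H (delta : hom H (H ⊗ H)) (lambda1 : hom H H)
    M (psi1 psi2 : hom (H ⊗ M) M) : hom (H ⊗ M) M :=
  psi1 ∘ (lambda1 ⊠ psi2) ∘ asc H H M ∘ (delta ⊠ idm M).

Definition brace_compat H (delta : hom H (H ⊗ H)) (lambda1 : hom H H)
    (mu2 : hom (H ⊗ H) H) M (psi1 psi2 : hom (H ⊗ M) M) : Prop :=
  psi2 ∘ (idm H ⊠ psi1) =
  psi1 ∘ (mu2 ⊠ Gamma delta lambda1 psi1 psi2) ∘ mid H H H M
    ∘ (delta ⊠ idm (H ⊗ M)).

Record hopf_brace := HopfBrace {
  hb_car :> C;
  hb_eps : hom hb_car K;
  hb_delta : hom hb_car (hb_car ⊗ hb_car);
  hb_eta1 : hom K hb_car;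
  hb_mu1 : hom (hb_car ⊗ hb_car) hb_car;
  hb_lambda1 : hom hb_car hb_car;
  hb_eta2 : hom K hb_car;
  hb_mu2 : hom (hb_car ⊗ hb_car) hb_car;
  hb_lambda2 : hom hb_car hb_car;
  hb_hopf1 : is_hopf hb_eta1 hb_mu1 hb_eps hb_delta hb_lambda1;
  hb_hopf2 : is_hopf hb_eta2 hb_mu2 hb_eps hb_delta hb_lambda2;
  hb_compat : brace_compat hb_delta hb_lambda1 hb_mu2 hb_mu1 hb_mu2
}.

Definition hb_H1 (HH : hopf_brace) : hopf_algebra := HopfAlgebra (hb_hopf1 HH).
Definition hb_H2 (HH : hopf_brace) : hopf_algebra := HopfAlgebra (hb_hopf2 HH).

Definition hb_Gamma (HH : hopf_brace) : hom (HH ⊗ HH) HH :=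
  Gamma (hb_delta HH) (hb_lambda1 HH) (hb_mu1 HH) (hb_mu2 HH).

Record brace_module (HH : hopf_brace) := BraceModule {
  bm_car : C;
  bm_psi1 : hom (HH ⊗ bm_car) bm_car;
  bm_psi2 : hom (HH ⊗ bm_car) bm_car;
  bm_mod1 : is_module (hb_eta1 HH) (hb_mu1 HH) bm_psi1;
  bm_mod2 : is_module (hb_eta2 HH) (hb_mu2 HH) bm_psi2;
  bm_compat : brace_compat (hb_delta HH) (hb_lambda1 HH) (hb_mu2 HH)
                bm_psi1 bm_psi2
}.

Record brace_module_hom (HH : hopf_brace) (M M' : brace_module HH) :=
  BraceModuleHom {
  bmh :> hom (bm_car M) (bm_car M');
  bmh_mod1 : is_module_morph (bm_psi1 M) (bm_psi1 M') bmh;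
  bmh_mod2 : is_module_morph (bm_psi2 M) (bm_psi2 M') bmh
}.

Definition is_invertible_1cocycle (A H : hopf_algebra)
    (phi : hom (A ⊗ H) H) (pi : hom A H) : Prop :=
  is_module_algebra (heta H) (hmu H) phi /\
  is_coalg_morph (heps A) (hdelta A) (heps H) (hdelta H) pi /\
  is_iso pi /\
  pi ∘ hmu A = hmu H ∘ (pi ⊠ phi) ∘ asc A A H ∘ (hdelta A ⊠ pi).

Record invertible_1cocycle := Invertible1Cocycle {
  ic_A : hopf_algebra;
  ic_H : hopf_algebra;
  ic_phi : hom (ic_A ⊗ ic_H) ic_H;
  ic_pi : hom ic_A ic_H;
  ic_P : is_invertible_1cocycle ic_phi ic_pi
}.

Record cocycle_module (p : invertible_1cocycle) := CocycleModule {
  cm_M : C;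
  cm_N : C;
  cm_phiM : hom (ic_A p ⊗ cm_M) cm_M;
  cm_varphiM : hom (ic_H p ⊗ cm_M) cm_M;
  cm_phiN : hom (ic_A p ⊗ cm_N) cm_N;
  cm_gamma : hom cm_N cm_M;
  cm_modMA : is_module (heta (ic_A p)) (hmu (ic_A p)) cm_phiM;
  cm_modMH : is_module (heta (ic_H p)) (hmu (ic_H p)) cm_varphiM;
  cm_compat :
    cm_phiM ∘ (idm (hcar (ic_A p)) ⊠ cm_varphiM) =
    cm_varphiM ∘ (ic_phi p ⊠ cm_phiM) ∘ mid (ic_A p) (ic_A p) (ic_H p) cm_M
      ∘ (hdelta (ic_A p) ⊠ idm (ic_H p ⊗ cm_M));
  cm_modNA : is_module (heta (ic_A p)) (hmu (ic_A p)) cm_phiN;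
  cm_gamma_iso : is_iso cm_gamma;
  cm_gammaP :
    cm_gamma ∘ cm_phiN =
    cm_varphiM ∘ (ic_pi p ⊠ cm_phiM) ∘ asc (ic_A p) (ic_A p) cm_M
      ∘ (hdelta (ic_A p) ⊠ cm_gamma)
}.

Record cocycle_module_hom (p : invertible_1cocycle) (X Y : cocycle_module p) :=
  CocycleModuleHom {
  cmh_h : hom (cm_M X) (cm_M Y);
  cmh_l : hom (cm_N X) (cm_N Y);
  cmh_hA : is_module_morph (cm_phiM X) (cm_phiM Y) cmh_h;
  cmh_hH : is_module_morph (cm_varphiM X) (cm_varphiM Y) cmh_h;
  cmh_lA : is_module_morph (cm_phiN X) (cm_phiN Y) cmh_l;
  cmh_gamma : cmh_h ∘ cm_gamma X = cm_gamma Y ∘ cmh_l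
}.

Lemma module_morph_id H M (psi : hom (H ⊗ M) M) :
  is_module_morph psi psi (idm M).
Proof. red; now rewrite tensm_id, comp_idl, comp_idr. Qed.

Lemma module_morph_comp H M M' M'' (psi : hom (H ⊗ M) M)
    (psi' : hom (H ⊗ M') M') (psi'' : hom (H ⊗ M'') M'')
    (g : hom M' M'') (f : hom M M') :
  is_module_morph psi' psi'' g -> is_module_morph psi psi' f ->
  is_module_morph psi psi'' (g ∘ f).
Proof.
unfold is_module_morph; intros Hg Hf.
rewrite <- comp_assoc, Hf, comp_assoc, Hg, <- comp_assoc, <- tensm_comp.
now rewrite comp_idl.
Qed.

Lemma brace_module_hom_eq (HH : hopf_brace) (M M' : brace_module HH)
    (f g : brace_module_hom M M') : bmh f = bmh g -> f = g.
Proof.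
destruct f as [f f1 f2], g as [g g1 g2]; simpl; intros <-.
now rewrite (proof_irrelevance _ f1 g1), (proof_irrelevance _ f2 g2).
Qed.

Lemma cocycle_module_hom_eq (p : invertible_1cocycle) (X Y : cocycle_module p)
    (f g : cocycle_module_hom X Y) :
  cmh_h f = cmh_h g -> cmh_l f = cmh_l g -> f = g.
Proof.
destruct f as [h l f1 f2 f3 f4], g as [h' l' g1 g2 g3 g4]; simpl.
intros <- <-.
now rewrite (proof_irrelevance _ f1 g1), (proof_irrelevance _ f2 g2),
  (proof_irrelevance _ f3 g3), (proof_irrelevance _ f4 g4).
Qed.

Definition brace_module_id (HH : hopf_brace) (M : brace_module HH) :
  brace_module_hom M M :=
  BraceModuleHom (module_morph_id (bm_psi1 M)) (module_morph_id (bm_psi2 M)).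

Definition brace_module_comp (HH : hopf_brace) (M M' M'' : brace_module HH)
    (g : brace_module_hom M' M'') (f : brace_module_hom M M') :
  brace_module_hom M M'' :=
  BraceModuleHom (module_morph_comp (bmh_mod1 g) (bmh_mod1 f))
    (module_morph_comp (bmh_mod2 g) (bmh_mod2 f)).

Definition brace_Mod (HH : hopf_brace) : category.
Proof.
refine (@Category (brace_module HH) (@brace_module_hom HH)
  (@brace_module_id HH) (@brace_module_comp HH) _ _ _);
  intros; apply brace_module_hom_eq; simpl.
- apply comp_idl.
- apply comp_idr.
- apply comp_assoc.
Defined.

Definition cocycle_module_id (p : invertible_1cocycle) (X : cocycle_module p) :
  cocycle_module_hom X X.
Proof.
refine (@CocycleModuleHom p X X (idm _) (idm _) (module_morph_id _)
  (module_morph_id _) (module_morph_id _) _).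
now rewrite comp_idl, comp_idr.
Defined.

Definition cocycle_module_comp (p : invertible_1cocycle)
    (X Y Z : cocycle_module p)
    (g : cocycle_module_hom Y Z) (f : cocycle_module_hom X Y) :
  cocycle_module_hom X Z.
Proof.
refine (@CocycleModuleHom p X Z (cmh_h g ∘ cmh_h f) (cmh_l g ∘ cmh_l f)
  (module_morph_comp (cmh_hA g) (cmh_hA f))
  (module_morph_comp (cmh_hH g) (cmh_hH f))
  (module_morph_comp (cmh_lA g) (cmh_lA f)) _).
now rewrite <- comp_assoc, cmh_gamma, comp_assoc, cmh_gamma, comp_assoc.
Defined.

Definition cocycle_Mod (p : invertible_1cocycle) : category.
Proof.
refine (@Category (cocycle_module p) (@cocycle_module_hom p)
  (@cocycle_module_id p) (@cocycle_module_comp p) _ _ _);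
  intros; apply cocycle_module_hom_eq; simpl;
  first [apply comp_idl | apply comp_idr | apply comp_assoc].
Defined.

End Structures.

(** * Diagrammatic calculus

    Morphisms are embedded in the one-sorted set [arr_opt], [None] being the
    result of an ill-typed composition.  There the identities [idto e]
    become plain identities, and the tensor product and the composition are
    associative up to Leibniz equality. *)
Section Calculus.
Variable C : strict_braided.

Inductive arr := Arr (A B : C) (f : hom A B).
Definition arr_opt := option arr.

Definition emb (A B : C) (f : hom A B) : arr_opt := Some (Arr f).

Definition ocomp (x y : arr_opt) : arr_opt :=
  match x, y with
  | Some (@Arr B' D g), Some (@Arr A B f) =>
      match excluded_middle_informative (B = B') with
      | left e => Some (Arr (g ∘ (idto e ∘ f)))
      | right _ => None
      end
  | _, _ => None
  end.

Definition otens (x y : arr_opt) : arr_opt :=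
  match x, y with
  | Some (Arr f), Some (Arr g) => Some (Arr (f ⊠ g))
  | _, _ => None
  end.

Notation "x • y" := (ocomp x y) (at level 41, right associativity).
Notation "x ** y" := (otens x y) (at level 36, right associativity).

Lemma emb_inj (A B : C) (f g : hom A B) : emb f = emb g -> f = g.
Proof.
unfold emb; intros E; injection E; intros E'.
now do 2 apply inj_pair2 in E'.
Qed.

Lemma emb_comp (A B D : C) (g : hom B D) (f : hom A B) :
  emb (g ∘ f) = emb g • emb f.
Proof.
unfold emb, ocomp; destruct (excluded_middle_informative (B = B)) as [e|n].
- now rewrite (proof_irrelevance _ e eq_refl); simpl; rewrite comp_idl.
- now destruct n.
Qed.

Lemma emb_idto (A B : C) (e : A = B) : emb (idto e) = emb (idm A).
Proof. now destruct e. Qed.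

Lemma emb_tens (A B A' B' : C) (f : hom A B) (g : hom A' B') :
  emb (f ⊠ g) = emb f ** emb g.
Proof. reflexivity. Qed.

Lemma ocompA (x y z : arr_opt) : (x • y) • z = x • (y • z).
Proof.
destruct x as [[A B f]|], y as [[A' B' g]|], z as [[A'' B'' h]|]; simpl; auto.
- destruct (excluded_middle_informative (B' = A)),
    (excluded_middle_informative (B'' = A')); simpl; auto;
  destruct (excluded_middle_informative _); subst; try easy.
  + rewrite (proof_irrelevance _ e1 eq_refl).
    destruct (excluded_middle_informative _) as [e|]; [|easy].
    rewrite (proof_irrelevance _ e eq_refl); simpl.
    now rewrite !comp_idl, comp_assoc.
- now destruct (excluded_middle_informative (B' = A)).
Qed.

Lemma emb_cast (A A' B B' : C) (p : A = A') (q : B = B')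
    (f : hom A B) (f' : hom A' B') :
  idto q ∘ f = f' ∘ idto p -> emb f = emb f'.
Proof.
destruct p, q; simpl; rewrite comp_idl, comp_idr; now intros ->.
Qed.

Lemma otensA (x y z : arr_opt) : (x ** y) ** z = x ** (y ** z).
Proof.
destruct x as [[A B f]|], y as [[A' B' g]|], z as [[A'' B'' h]|]; simpl; auto.
exact (emb_cast (tensm_assoc f g h)).
Qed.

Lemma otens1l (x : arr_opt) : emb (idm (unit_ob : C)) ** x = x.
Proof. destruct x as [[A B f]|]; auto; exact (emb_cast (tensm_unitl f)). Qed.

Lemma otens1r (x : arr_opt) : x ** emb (idm (unit_ob : C)) = x.
Proof. destruct x as [[A B f]|]; auto; exact (emb_cast (tensm_unitr f)). Qed.

Fixpoint tensl (l : list C) : C :=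
  match l with [] => unit_ob | A :: l' => A ⊗ tensl l' end.

Definition oid (l : list C) : arr_opt := emb (idm (tensl l)).

Lemma oid_nil : oid [] = emb (idm (unit_ob : C)).
Proof. reflexivity. Qed.

Lemma oid_cons A l : oid (A :: l) = emb (idm A) ** oid l.
Proof. unfold oid; simpl; now rewrite <- tensm_id. Qed.

Lemma oid_app l m : oid (l ++ m) = oid l ** oid m.
Proof.
induction l as [|A l IH]; cbn [app].
- now rewrite oid_nil, otens1l.
- now rewrite !oid_cons, IH, otensA.
Qed.

Lemma tensl_app l m : tensl (l ++ m) = tensl l ⊗ tensl m.
Proof.
induction l as [|A l IH]; simpl.
- now rewrite tens_unitl.
- now rewrite IH, tens_assoc.
Qed.

Definition typed (x : arr_opt) (a b : list C) : Prop :=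
  exists f : hom (tensl a) (tensl b), x = emb f.

Lemma typed_emb (A B : C) (f : hom A B) a b :
  A = tensl a -> B = tensl b -> typed (emb f) a b.
Proof. intros -> ->; now exists f. Qed.

Lemma typed_id a : typed (oid a) a a.
Proof. now exists (idm (tensl a)). Qed.

Lemma typed_comp x y a b c : typed x b c -> typed y a b -> typed (x • y) a c.
Proof. intros [f ->] [g ->]; exists (f ∘ g); now rewrite emb_comp. Qed.

Lemma typed_tens x y a b a' b' :
  typed x a b -> typed y a' b' -> typed (x ** y) (a ++ a') (b ++ b').
Proof.
intros [f ->] [g ->]; rewrite <- emb_tens.
apply typed_emb; now rewrite tensl_app.
Qed.

Lemma oidl x a b : typed x a b -> oid b • x = x.
Proof. intros [f ->]; unfold oid; now rewrite <- emb_comp, comp_idl. Qed.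

Lemma oidr x a b : typed x a b -> x • oid a = x.
Proof. intros [f ->]; unfold oid; now rewrite <- emb_comp, comp_idr. Qed.

Lemma otens_comp x y x' y' a b c a' b' c' :
  typed x b c -> typed y a b -> typed x' b' c' -> typed y' a' b' ->
  (x • y) ** (x' • y') = (x ** x') • (y ** y').
Proof.
intros [f ->] [g ->] [f' ->] [g' ->].
now rewrite <- !emb_comp, <- !emb_tens, tensm_comp, emb_comp.
Qed.

(** [layer l x r] is [l ⊗ x ⊗ r]. *)
Definition layer (l : list C) (x : arr_opt) (r : list C) : arr_opt :=
  oid l ** (x ** oid r).

Lemma typed_layer l r x a b :
  typed x a b -> typed (layer l x r) (l ++ a ++ r) (l ++ b ++ r).
Proof. intros Hx; repeat apply typed_tens; auto using typed_id. Qed.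

Lemma layer_layer l l' r r' x :
  layer l (layer l' x r') r = layer (l ++ l') x (r' ++ r).
Proof. unfold layer; now rewrite !oid_app, !otensA. Qed.

Lemma layer_id l r a : layer l (oid a) r = oid (l ++ a ++ r).
Proof. unfold layer; now rewrite !oid_app. Qed.

Lemma layer_nil x : layer [] x [] = x.
Proof. unfold layer; now rewrite oid_nil, otens1l, otens1r. Qed.

Lemma layer_comp l r x y a b c : typed x b c -> typed y a b ->
  layer l (x • y) r = layer l x r • layer l y r.
Proof.
intros Hx Hy; unfold layer.
rewrite <- (otens_comp (typed_id l) (typed_id l)
  (typed_tens Hx (typed_id r)) (typed_tens Hy (typed_id r))).
rewrite <- (otens_comp Hx Hy (typed_id r) (typed_id r)).
now rewrite !(oidl (typed_id _)).
Qed.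

Lemma otens_layer x y a b a' b' : typed x a b -> typed y a' b' ->
  x ** y = layer [] x b' • layer a y [].
Proof.
intros Hx Hy; unfold layer; rewrite oid_nil, otens1l, otens1r.
rewrite <- (otens_comp Hx (typed_id a) (typed_id b') Hy).
now rewrite (oidr Hx), (oidl Hy).
Qed.

Lemma slide l m r x a b y a' b' : typed x a b -> typed y a' b' ->
  layer l x (m ++ b' ++ r) • layer (l ++ a ++ m) y r =
  layer (l ++ b ++ m) y r • layer l x (m ++ a' ++ r).
Proof.
intros Hx Hy; unfold layer; rewrite !oid_app, !otensA.
pose proof (typed_id l) as Il; pose proof (typed_id m) as Im.
pose proof (typed_id r) as Ir; pose proof (typed_id a) as Ia.
pose proof (typed_id b) as Ib; pose proof (typed_id a') as Ia'.
pose proof (typed_id b') as Ib'.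
rewrite <- (otens_comp Il Il
  (typed_tens Hx (typed_tens Im (typed_tens Ib' Ir)))
  (typed_tens Ia (typed_tens Im (typed_tens Hy Ir)))).
rewrite <- (otens_comp Il Il
  (typed_tens Ib (typed_tens Im (typed_tens Hy Ir)))
  (typed_tens Hx (typed_tens Im (typed_tens Ia' Ir)))).
rewrite <- (otens_comp Hx Ia (typed_tens Im (typed_tens Ib' Ir))
  (typed_tens Im (typed_tens Hy Ir))).
rewrite <- (otens_comp Ib Hx (typed_tens Im (typed_tens Hy Ir))
  (typed_tens Im (typed_tens Ia' Ir))).
rewrite <- (otens_comp Im Im (typed_tens Ib' Ir) (typed_tens Hy Ir)).
rewrite <- (otens_comp Im Im (typed_tens Hy Ir) (typed_tens Ia' Ir)).
rewrite <- (otens_comp Ib' Hy Ir Ir), <- (otens_comp Hy Ia' Ir Ir).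
now rewrite (oidr Hx), (oidl Hx), (oidr Hy), (oidl Hy).
Qed.

End Calculus.

Declare Scope calc_scope.
Notation "x • y" := (ocomp x y) (at level 41, right associativity) : calc_scope.

(** The following tactics work on equations between right-nested composites
    of layers.  [use E l r] rewrites with [E], tensored by [l] and [r];
    [useb E l r] does it from right to left; [exch x y] exchanges the
    adjacent layers of [x] and [y] that act on disjoint factors. *)
Ltac typing x :=
  lazymatch x with
  | ocomp ?g ?f =>
      let p := typing g in let q := typing f in constr:(typed_comp p q)
  | layer ?l ?y ?r => let p := typing y in constr:(typed_layer l r p)
  | oid ?a => constr:(typed_id a)
  | _ => lazymatch goal with H : typed x _ _ |- _ => H end
  end.

Ltac distr_in E :=
  repeat match type of E with
  | context [layer ?l (ocomp ?x ?y) ?r] =>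
      let p := typing x in let q := typing y in
      rewrite (layer_comp l r p q) in E
  | context [layer ?l (layer ?l' ?x ?r') ?r] =>
      rewrite (layer_layer l l' r r' x) in E
  | context [layer ?l (oid ?a) ?r] => rewrite (layer_id l r a) in E
  end; cbn [app] in E.

Ltac distr :=
  repeat match goal with
  | |- context [layer ?l (ocomp ?x ?y) ?r] =>
      let p := typing x in let q := typing y in
      rewrite (layer_comp l r p q)
  | |- context [layer ?l (layer ?l' ?x ?r') ?r] =>
      rewrite (layer_layer l l' r r' x)
  | |- context [layer ?l (oid ?a) ?r] => rewrite (layer_id l r a)
  end; cbn [app].

Ltac drop_id :=
  repeat match goal with
  | |- context [ocomp (oid ?a) (ocomp ?y ?z)] =>
      let p := typing y in
      replace (ocomp (oid a) (ocomp y z)) with (ocomp y z)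
        by (rewrite <- (ocompA (oid a) y z); now rewrite (oidl p))
  | |- context [ocomp (oid ?a) ?y] =>
      let p := typing y in
      replace (ocomp (oid a) y) with y by (symmetry; exact (oidl p))
  end.

Ltac norm := rewrite ?ocompA; drop_id.

Ltac lift E l r :=
  let E0 := fresh in
  pose proof (f_equal (fun x => layer l x r) E) as E0; cbv beta in E0;
  distr_in E0; revert E0.

Ltac tailed E0 :=
  constr:(fun z => ltac:(
    let F := fresh in
    pose proof (f_equal (fun x => ocomp x z) E0) as F; cbv beta in F;
    rewrite ?ocompA in F; exact F)).

Ltac use_ E l r :=
  lift E l r; let E0 := fresh in intros E0;
  let F := tailed E0 in rewrite F; clear E0; norm.
Ltac useb_ E l r :=
  lift E l r; let E0 := fresh in intros E0;
  let F := tailed E0 in rewrite <- F; clear E0; norm.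


Tactic Notation "use" constr(E) open_constr(l) open_constr(r) := use_ E l r.
Tactic Notation "useb" constr(E) open_constr(l) open_constr(r) := useb_ E l r.

Ltac exch_ l r x l2 r2 y :=
  let tx := typing x in let ty := typing y in
  lazymatch type of tx with typed _ ?a ?b =>
  lazymatch type of ty with typed _ ?a' ?b' =>
    first
    [ let n := eval cbv in (length l + length a)%nat in
      let m := eval cbn [skipn] in (skipn n l2) in
      let E := fresh in
      pose proof (slide l m r2 tx ty) as E; cbn [app] in E;
      let F := tailed E in rewrite F; clear E
    | let n := eval cbv in (length l2 + length b')%nat in
      let m := eval cbn [skipn] in (skipn n l) in
      let E := fresh in
      pose proof (slide l2 m r ty tx) as E; cbn [app] in E;
      let F := tailed E in rewrite <- F; clear E ]
  end end.

Ltac exch x y :=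
  match goal with
  | |- context [ocomp (layer ?l x ?r) (ocomp (layer ?l2 y ?r2) _)] =>
    exch_ l r x l2 r2 y
  end.

Ltac exch_at k x y :=
  match goal with
  | |- context [ocomp (layer k x ?r) (ocomp (layer ?l2 y ?r2) _)] =>
    exch_ k r x l2 r2 y
  end.

(** Inserts identity layers so that both sides are composites of layers
    ending with an identity. *)
Ltac start :=
  match goal with |- ?x = ?y =>
    let p := typing x in let q := typing y in
    refine (eq_trans (eq_sym (oidr p)) (eq_trans _ (oidr q)));
    refine (eq_trans (f_equal (fun t => ocomp t _) (eq_sym (layer_nil x)))
      (eq_trans _ (f_equal (fun t => ocomp t _) (layer_nil y))))
  end;
  distr; norm.

Section BraceCalculus.
Local Open Scope calc_scope.
Variable C : strict_braided.
Variables H M : C.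
Variables m1 u1 m2 u2 e d s c p1 p2 G : arr_opt C.
Hypothesis t_m1 : typed m1 [H; H] [H].
Hypothesis t_u1 : typed u1 [] [H].
Hypothesis t_m2 : typed m2 [H; H] [H].
Hypothesis t_u2 : typed u2 [] [H].
Hypothesis t_e : typed e [H] [].
Hypothesis t_d : typed d [H] [H; H].
Hypothesis t_s : typed s [H] [H].
Hypothesis t_c : typed c [H; H] [H; H].
Hypothesis t_p1 : typed p1 [H; M] [M].
Hypothesis t_p2 : typed p2 [H; M] [M].
Hypothesis t_G : typed G [H; M] [M].
Notation L := layer.
Hypothesis m2u : m2 • L [] u2 [H] = oid [H].
Hypothesis p1m : p1 • L [] m1 [M] = p1 • L [H] p1 [].
Hypothesis p1u : p1 • L [] u1 [M] = oid [M].
Hypothesis p2m : p2 • L [] m2 [M] = p2 • L [H] p2 [].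
Hypothesis p2u : p2 • L [] u2 [M] = oid [M].
Hypothesis dA : L [] d [H] • d = L [H] d [] • d.
Hypothesis ed : L [] e [H] • d = oid [H].
Hypothesis sd : m1 • L [] s [H] • d = u1 • e.
Hypothesis ds : m1 • L [H] s [] • d = u1 • e.
Hypothesis dm2 : d • m2 =
  L [] m2 [H] • L [H; H] m2 [] • L [H] c [H] • L [] d [H; H] • L [H] d [].
Hypothesis du2 : d • u2 = L [] u2 [H] • u2.
Hypothesis dc : L [] d [H] • c = L [H] c [] • L [] c [H] • L [H] d [].
Hypothesis cd : L [H] d [] • c = L [] c [H] • L [H] c [] • L [] d [H].
Hypothesis em2 : e • m2 = e • L [H] e [].
Hypothesis ce : L [] e [H] • c = L [H] e [].
Hypothesis cu2 : c • L [] u2 [H] = L [H] u2 [].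
Hypothesis Gdef : G = p1 • L [] s [M] • L [H] p2 [] • L [] d [M].
Variable Q : arr_opt C.
Hypothesis t_Q : typed Q [H; H] [H].
Hypothesis Qdef : Q = m1 • L [] s [H] • L [H] m2 [] • L [] d [H].
Hypothesis compat : p2 • L [H] p1 [] =
  p1 • L [] m2 [M] • L [H; H] G [] • L [H] c [M] • L [] d [H; M].

Lemma calc_A : p1 • L [H] G [] • L [] d [M] = p2.
Proof.
start.
use Gdef [H] [].
useb p1m [] [].
useb dA [] [M].
exch p2 d.
use ds [] [M].
use p1u [] [].
exch e p2.
use ed [] [M].
reflexivity.
Qed.

Lemma calc_B : G • L [H] p1 [] =
  p1 • L [] Q [M] • L [H; H] G [] • L [H] c [M] • L [] d [H; M].
Proof.
start.
use Gdef [] [].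
use Qdef [] [M].
use p1m [] [].
exch d p1.
use compat [H] [].
exch s p1.
useb dA [] [H; M].
exch d G.
exch d c.
reflexivity.
Qed.

Lemma calc_coassoc :
  L [H] c [H; H; H] • L [] d [H; H; H; H] • L [H] d [H; H] •
    L [H] c [H] • L [] d [H; H] • L [H] d [] =
  L [H; H; H] c [H] • L [H; H] d [H; H] • L [H; H; H] d [] •
    L [H] c [H] • L [] d [H; H] • L [H] d [].
Proof.
start.
use dc [H] [H].
exch_at [H; H] d d.
use dA [H] [].
exch d c.
exch d c.
use dA [] [H; H; H].
exch_at [H; H] d d.
use cd [H] [H].
exch_at [H; H; H; H] d c.
exch_at [H; H; H; H] d c.
exch_at [H; H; H; H] d d.
exch_at [H; H; H] d d.
exch_at [H; H; H] c c.
reflexivity.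
Qed.

Lemma calc_K : p2 • L [H] p2 [] =
  p1 • L [] m2 [M] • L [H; H] G [] • L [H; H; H] G [] •
    L [H] c [H; M] • L [] d [H; H; M] • L [H] d [M].
Proof.
start.
useb calc_A [H] [].
use compat [] [].
exch d G.
exch c G.
reflexivity.
Qed.

Lemma calc_C : G • L [] m2 [M] = G • L [H] G [].
Proof.
start.
use Gdef [] [].
use dm2 [] [M].
exch p2 m2.
use p2m [H; H] [].
use calc_K [H; H] [].
useb calc_coassoc [] [M].
exch_at [H; H; H; H; H] G c.
exch_at [H; H; H; H; H] G d.
exch_at [H; H; H; H] G d.
exch_at [H; H; H; H] G c.
exch_at [H; H; H; H] G d.
exch_at [H; H; H] G d.
exch m2 p1.
exch s p1.
useb p1m [] [].
useb dm2 [] [M].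
use sd [] [M].
use p1u [] [].
use em2 [] [M].
exch_at [H] e G.
exch_at (@nil C) e G.
exch_at [H] e G.
exch_at (@nil C) e G.
use ce [H] [H; M].
exch_at [H; H] e d.
use ed [] [H; M].
use ed [H] [M].
reflexivity.
Qed.

Lemma calc_unit : G • L [] u2 [M] = oid [M].
Proof.
assert (E : p1 • L [H] G [] • L [H] u2 [M] = p1).
{ transitivity (p2 • L [H] p1 [] • L [] u2 [H; M]); start.
  - use compat [] [].
    use du2 [] [H; M].
    exch c u2.
    use cu2 [] [M].
    exch G u2.
    use m2u [] [M].
    reflexivity.
  - exch p1 u2.
    use p2u [] [].
    reflexivity. }
rewrite <- p1u, <- E.
start.
exch u2 u1.
exch G u1.
use p1u [] [].
reflexivity.
Qed.
End BraceCalculus.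

Section UnitCalculus.
Local Open Scope calc_scope.
Variable C : strict_braided.
Variables H : C.
Variables m1 u1 m2 u2 e d s Q : arr_opt C.
Hypothesis t_m1 : typed m1 [H; H] [H].
Hypothesis t_u1 : typed u1 [] [H].
Hypothesis t_m2 : typed m2 [H; H] [H].
Hypothesis t_u2 : typed u2 [] [H].
Hypothesis t_e : typed e [H] [].
Hypothesis t_d : typed d [H] [H; H].
Hypothesis t_s : typed s [H] [H].
Hypothesis t_Q : typed Q [H; H] [H].
Notation L := layer.
Hypothesis m1ul : m1 • L [] u1 [H] = oid [H].
Hypothesis m1ur : m1 • L [H] u1 [] = oid [H].
Hypothesis m2ul : m2 • L [] u2 [H] = oid [H].
Hypothesis m2ur : m2 • L [H] u2 [] = oid [H].
Hypothesis sd : m1 • L [] s [H] • d = u1 • e.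
Hypothesis du2 : d • u2 = L [] u2 [H] • u2.
Hypothesis eu2 : e • u2 = oid [].
Hypothesis Qdef : Q = m1 • L [] s [H] • L [H] m2 [] • L [] d [H].
Hypothesis Qu2 : Q • L [] u2 [H] = oid [H].

Lemma calc_su2 : s • u2 = u1.
Proof.
transitivity (Q • L [] u2 [H] • u1); start.
- use Qdef [] [].
  use du2 [] [H].
  exch m2 u2.
  use m2ul [] [].
  exch u2 u1.
  exch s u1.
  use m1ur [] [].
  reflexivity.
- use Qu2 [] [].
  reflexivity.
Qed.

Lemma calc_u : u1 = u2.
Proof.
transitivity (m1 • L [] s [H] • d • u2); start.
- use sd [] [].
  use eu2 [] [].
  reflexivity.
- use du2 [] [].
  use calc_su2 [] [H].
  use m1ul [] [].
  reflexivity.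
Qed.

Lemma calc_D : Q • L [H] u1 [] = u1 • e.
Proof.
start.
use Qdef [] [].
exch d u1.
rewrite calc_u at 1.
use m2ur [H] [].
use sd [] [].
reflexivity.
Qed.
End UnitCalculus.

Section Bridge.
Local Open Scope calc_scope.
Variable C : strict_braided.

Lemma emb_idto_l (A B B' : C) (e : B = B') (f : hom A B) :
  emb (idto e ∘ f) = emb f.
Proof. destruct e; simpl; now rewrite comp_idl. Qed.

Lemma emb_idto_r (A A' B : C) (e : A' = A) (f : hom A B) :
  emb (f ∘ idto e) = emb f.
Proof. destruct e; simpl; now rewrite comp_idr. Qed.

Lemma emb_tens_idto_l (A B B' D : C) (e : B = B') (f : hom D (A ⊗ B)) :
  emb ((idm A ⊠ idto e) ∘ f) = emb f.
Proof. destruct e; simpl; now rewrite tensm_id, comp_idl. Qed.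

Lemma emb_tens_idto_r (A B B' D : C) (e : B' = B) (f : hom (A ⊗ B) D) :
  emb (f ∘ (idm A ⊠ idto e)) = emb f.
Proof. destruct e; simpl; now rewrite tensm_id, comp_idr. Qed.

Lemma emb_mid (A B D E : C) :
  emb (mid A B D E) = otens (emb (idm A)) (otens (emb (braid B D)) (emb (idm E))).
Proof.
unfold mid, asc, asci.
now rewrite emb_idto_r, emb_tens_idto_r, <- !comp_assoc, emb_idto_l,
  emb_tens_idto_l.
Qed.

Lemma emb_idm_tens (A B : C) :
  emb (idm (A ⊗ B)) = otens (emb (idm A)) (emb (idm B)).
Proof. now rewrite <- tensm_id. Qed.

Lemma oid_one (A : C) : oid [A] = emb (idm A).
Proof. unfold oid; simpl; now rewrite tens_unitr. Qed.

Lemma typed1 (A B : C) (f : hom A B) : typed (emb f) [A] [B].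
Proof. apply typed_emb; simpl; now rewrite tens_unitr. Qed.
Lemma typed01 (B : C) (f : hom K B) : typed (emb f) [] [B].
Proof. apply typed_emb; simpl; now rewrite ?tens_unitr. Qed.
Lemma typed10 (B : C) (f : hom B K) : typed (emb f) [B] [].
Proof. apply typed_emb; simpl; now rewrite ?tens_unitr. Qed.
Lemma typed21 (A A' B : C) (f : hom (A ⊗ A') B) : typed (emb f) [A; A'] [B].
Proof. apply typed_emb; simpl; now rewrite ?tens_unitr. Qed.
Lemma typed12 (A B B' : C) (f : hom A (B ⊗ B')) : typed (emb f) [A] [B; B'].
Proof. apply typed_emb; simpl; now rewrite ?tens_unitr. Qed.
Lemma typed22 (A A' B B' : C) (f : hom (A ⊗ A') (B ⊗ B')) :
  typed (emb f) [A; A'] [B; B'].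
Proof. apply typed_emb; simpl; now rewrite ?tens_unitr. Qed.

Lemma emb_braid_unitl (A : C) : emb (braid (K : C) A) = emb (idm A).
Proof.
assert (E : emb (braid (K : C) A) = emb (braid (K : C) A) • emb (braid (K : C) A)).
{ pose proof (f_equal (@emb C _ _) (braid_tensl (K : C) K A)) as E.
  unfold asc, asci in E.
  rewrite emb_idto_r, <- !comp_assoc, emb_idto_l, emb_comp, emb_idto_l in E.
  rewrite !emb_tens, otens1l, otens1r in E.
  now rewrite (tens_unitl (K : C)) in E. }
destruct (braid_iso (K : C) A) as [g [Hg _]].
apply (f_equal (@emb C _ _)) in Hg; rewrite emb_comp in Hg.
apply (f_equal (ocomp (emb g))) in E.
rewrite <- ocompA, Hg, emb_idm_tens, otens1l in E.
assert (T : typed (emb (braid (K : C) A)) [A] [A])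
  by (apply typed_emb; simpl; now rewrite ?tens_unitr, ?tens_unitl).
rewrite <- oid_one in *; now rewrite (oidl T) in E.
Qed.

Lemma emb_braid_unitr (A : C) : emb (braid A (K : C)) = emb (idm A).
Proof.
assert (E : emb (braid A (K : C)) = emb (braid A (K : C)) • emb (braid A (K : C))).
{ pose proof (f_equal (@emb C _ _) (braid_tensr A (K : C) K)) as E.
  unfold asc, asci in E.
  rewrite emb_idto_r, <- !comp_assoc, emb_idto_l, emb_comp, emb_idto_l in E.
  rewrite !emb_tens, otens1l, otens1r in E.
  now rewrite (tens_unitl (K : C)) in E. }
destruct (braid_iso A (K : C)) as [g [Hg _]].
apply (f_equal (@emb C _ _)) in Hg; rewrite emb_comp in Hg.
apply (f_equal (ocomp (emb g))) in E.
rewrite <- ocompA, Hg, emb_idm_tens, otens1r in E.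
assert (T : typed (emb (braid A (K : C))) [A] [A])
  by (apply typed_emb; simpl; now rewrite ?tens_unitr, ?tens_unitl).
rewrite <- oid_one in *; now rewrite (oidl T) in E.
Qed.

Lemma emb_braid_tensr (A B D : C) : emb (braid A (B ⊗ D)) =
  layer [B] (emb (braid A D)) [] • layer [] (emb (braid A B)) [D].
Proof.
rewrite braid_tensr; unfold asc, asci, layer.
rewrite emb_idto_r, <- !comp_assoc, emb_idto_l, emb_comp, emb_idto_l.
now rewrite !emb_tens, !oid_one, !oid_nil, otens1l, otens1r.
Qed.

Lemma emb_braid_tensl (A B D : C) : emb (braid (A ⊗ B) D) =
  layer [] (emb (braid A D)) [B] • layer [A] (emb (braid B D)) [].
Proof.
rewrite braid_tensl; unfold asc, asci, layer.
rewrite emb_idto_r, <- !comp_assoc, emb_idto_l, emb_comp, emb_idto_l.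
now rewrite !emb_tens, !oid_one, !oid_nil, otens1l, otens1r.
Qed.

End Bridge.

Ltac to_emb_in E :=
  apply (f_equal (@emb _ _ _)) in E;
  unfold convolution, tens_mu, tens_eta, unit_dup, lun, run, asc, asci in E;
  rewrite <- ?comp_assoc in E;
  repeat first [ rewrite emb_idto_l in E | rewrite emb_idto_r in E
               | rewrite emb_idto in E | rewrite emb_comp in E ];
  rewrite ?emb_tens, ?emb_mid, ?emb_idm_tens in E.

Ltac to_emb :=
  apply emb_inj;
  unfold tens_mu, tens_eta, unit_dup, lun, run, asc, asci;
  rewrite <- ?comp_assoc;
  repeat first [ rewrite emb_idto_l | rewrite emb_idto_r
               | rewrite emb_idto | rewrite emb_comp ];
  rewrite ?emb_tens, ?emb_mid, ?emb_idm_tens.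

Ltac unlayer :=
  unfold layer; rewrite ?oid_cons, ?oid_nil, ?otensA;
  rewrite ?otensA, ?otens1l, ?otens1r, ?ocompA.

Ltac by_emb E := to_emb_in E; revert E; unlayer; intros E; exact E.

Section BraceFacts.
Local Open Scope calc_scope.
Variable C : strict_braided.
Variable HH : hopf_brace C.
Variable X : brace_module HH.
Notation L := layer.
Notation H := (hb_car HH).
Notation M := (bm_car X).
Notation m1 := (emb (hb_mu1 HH)).
Notation u1 := (emb (hb_eta1 HH)).
Notation m2 := (emb (hb_mu2 HH)).
Notation u2 := (emb (hb_eta2 HH)).
Notation e := (emb (hb_eps HH)).
Notation d := (emb (hb_delta HH)).
Notation s := (emb (hb_lambda1 HH)).
Notation c := (emb (braid H H)).
Notation p1 := (emb (bm_psi1 X)).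
Notation p2 := (emb (bm_psi2 X)).
Notation Gamma_X :=
  (Gamma (hb_delta HH) (hb_lambda1 HH) (bm_psi1 X) (bm_psi2 X)).
Notation G := (emb Gamma_X).
Notation Q := (emb (hb_Gamma HH)).

Lemma act1_mul : p1 • L [] m1 [M] = p1 • L [H] p1 [].
Proof. destruct (bm_mod1 X) as [_ E]; by_emb E. Qed.
Lemma act1_unit : p1 • L [] u1 [M] = oid [M].
Proof. destruct (bm_mod1 X) as [E _]; by_emb E. Qed.
Lemma act2_mul : p2 • L [] m2 [M] = p2 • L [H] p2 [].
Proof. destruct (bm_mod2 X) as [_ E]; by_emb E. Qed.
Lemma act2_unit : p2 • L [] u2 [M] = oid [M].
Proof. destruct (bm_mod2 X) as [E _]; by_emb E. Qed.

Lemma mul1_unitl : m1 • L [] u1 [H] = oid [H].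
Proof. destruct (hb_hopf1 HH) as [[E _] _]; by_emb E. Qed.
Lemma mul1_unitr : m1 • L [H] u1 [] = oid [H].
Proof. destruct (hb_hopf1 HH) as [[_ [E _]] _]; by_emb E. Qed.
Lemma mul2_unitl : m2 • L [] u2 [H] = oid [H].
Proof. destruct (hb_hopf2 HH) as [[E _] _]; by_emb E. Qed.
Lemma mul2_unitr : m2 • L [H] u2 [] = oid [H].
Proof. destruct (hb_hopf2 HH) as [[_ [E _]] _]; by_emb E. Qed.

Lemma delta_coassoc : L [] d [H] • d = L [H] d [] • d.
Proof. destruct (hb_hopf1 HH) as [_ [[_ [_ E]] _]]; by_emb E. Qed.
Lemma delta_counit : L [] e [H] • d = oid [H].
Proof. destruct (hb_hopf1 HH) as [_ [[E _] _]]; by_emb E. Qed.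

Lemma antipode_l : m1 • L [] s [H] • d = u1 • e.
Proof. destruct (hb_hopf1 HH) as [_ [_ [_ [_ [E _]]]]]; by_emb E. Qed.
Lemma antipode_r : m1 • L [H] s [] • d = u1 • e.
Proof. destruct (hb_hopf1 HH) as [_ [_ [_ [_ [_ E]]]]]; by_emb E. Qed.

Lemma delta_mul2 : d • m2 =
  L [] m2 [H] • L [H; H] m2 [] • L [H] c [H] • L [] d [H; H] • L [H] d [].
Proof.
destruct (hb_hopf2 HH) as [_ [_ [_ [[_ E] _]]]]; to_emb_in E.
rewrite (otens_layer (typed21 _) (typed21 _)) in E.
rewrite (otens_layer (typed12 _) (typed12 _)) in E.
revert E; unlayer; intros E; exact E.
Qed.

Lemma delta_unit2 : d • u2 = L [] u2 [H] • u2.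
Proof.
destruct (hb_hopf2 HH) as [_ [_ [_ [[E _] _]]]]; to_emb_in E.
rewrite (otens_layer (typed01 _) (typed01 _)) in E.
revert E; unlayer; intros E; exact E.
Qed.

Lemma eps_mul2 : e • m2 = e • L [H] e [].
Proof.
destruct (hb_hopf2 HH) as [_ [_ [[_ E] _]]]; to_emb_in E.
rewrite (otens_layer (typed10 _) (typed10 _)) in E.
revert E; unlayer; intros E; exact E.
Qed.

Lemma eps_unit2 : e • u2 = oid [].
Proof. destruct (hb_hopf2 HH) as [_ [_ [[E _] _]]]; by_emb E. Qed.

Lemma braid_delta_l : L [] d [H] • c = L [H] c [] • L [] c [H] • L [H] d [].
Proof.
pose proof (braid_nat (idm H) (hb_delta HH)) as E; to_emb_in E.
rewrite emb_braid_tensr in E.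
revert E; unlayer; intros E; symmetry; exact E.
Qed.

Lemma braid_delta_r : L [H] d [] • c = L [] c [H] • L [H] c [] • L [] d [H].
Proof.
pose proof (braid_nat (hb_delta HH) (idm H)) as E; to_emb_in E.
rewrite emb_braid_tensl in E.
revert E; unlayer; intros E; symmetry; exact E.
Qed.

Lemma braid_eps : L [] e [H] • c = L [H] e [].
Proof.
pose proof (braid_nat (idm H) (hb_eps HH)) as E; to_emb_in E.
rewrite emb_braid_unitr, <- oid_one in E.
pose proof (oidl (typed_layer [H] [] (typed10 (hb_eps HH)))) as F.
revert E F; unlayer; intros E F; cbn [app] in F.
rewrite oid_cons, oid_nil, otens1r in F; congruence.
Qed.

Lemma braid_unit2 : c • L [] u2 [H] = L [H] u2 [].
Proof.
pose proof (braid_nat (hb_eta2 HH) (idm H)) as E; to_emb_in E.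
rewrite emb_braid_unitl, <- oid_one in E.
pose proof (oidr (typed_layer [H] [] (typed01 (hb_eta2 HH)))) as F.
revert E F; unlayer; intros E F; cbn [app] in F.
rewrite oid_cons, oid_nil, otens1r in F; congruence.
Qed.

Lemma emb_Gamma (N : C) (f1 f2 : hom (H ⊗ N) N) :
  emb (Gamma (hb_delta HH) (hb_lambda1 HH) f1 f2) =
  emb f1 • L [] s [N] • L [H] (emb f2) [] • L [] d [N].
Proof.
unfold Gamma, asc; rewrite <- !comp_assoc, emb_comp, emb_comp, emb_idto_l.
rewrite !emb_tens.
rewrite (otens_layer (typed1 _) (typed21 _)); now unlayer.
Qed.

Lemma act_compat : p2 • L [H] p1 [] =
  p1 • L [] m2 [M] • L [H; H] G [] • L [H] c [M] • L [] d [H; M].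
Proof.
pose proof (bm_compat X) as E; red in E; to_emb_in E.
rewrite (otens_layer (typed21 _) (typed21 _)) in E.
revert E; unlayer; intros E; exact E.
Qed.

Hint Resolve typed1 typed01 typed10 typed21 typed12 typed22 : calc.
Hint Resolve act1_mul act1_unit act2_mul act2_unit mul1_unitl mul1_unitr
  mul2_unitl mul2_unitr delta_coassoc delta_counit antipode_l antipode_r
  delta_mul2 delta_unit2 eps_mul2 eps_unit2 braid_delta_l braid_delta_r
  braid_eps braid_unit2 emb_Gamma act_compat : calc.

Lemma emb_psi2_Gamma : p1 • L [H] G [] • L [] d [M] = p2.
Proof. apply (@calc_A C H M m1 u1 e d s p1 p2 G); auto with calc. Qed.

Lemma emb_Gamma_psi1 : G • L [H] p1 [] =
  p1 • L [] Q [M] • L [H; H] G [] • L [H] c [M] • L [] d [H; M].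
Proof. apply (@calc_B C H M m1 m2 d s c p1 p2 G) with (Q := Q); auto with calc; apply emb_Gamma. Qed.

Lemma emb_Gamma_mul : G • L [] m2 [M] = G • L [H] G [].
Proof. apply (@calc_C C H M m1 u1 m2 e d s c p1 p2 G); auto with calc. Qed.

Lemma emb_Gamma_unit : G • L [] u2 [M] = oid [M].
Proof. apply (@calc_unit C H M u1 m2 u2 d c p1 p2 G); auto with calc. Qed.

Lemma Gamma_module : is_module (hb_eta2 HH) (hb_mu2 HH) Gamma_X.
Proof.
split; to_emb.
- pose proof emb_Gamma_unit as E; revert E; unlayer; intros E; exact E.
- pose proof emb_Gamma_mul as E; revert E; unlayer; intros E; exact E.
Qed.

Lemma Gamma_psi1 :
  Gamma_X ∘ (idm H ⊠ bm_psi1 X) =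
  bm_psi1 X ∘ (hb_Gamma HH ⊠ Gamma_X) ∘ mid H H H M
    ∘ (hb_delta HH ⊠ idm (H ⊗ M)).
Proof.
to_emb; rewrite (otens_layer (typed21 (hb_Gamma HH)) (typed21 Gamma_X)).
pose proof emb_Gamma_psi1 as E; revert E; unlayer; intros E; exact E.
Qed.

Lemma psi2_Gamma :
  bm_psi2 X =
  bm_psi1 X ∘ (idm H ⊠ Gamma_X) ∘ asc H H M ∘ (hb_delta HH ⊠ idm M).
Proof.
to_emb; symmetry.
pose proof emb_psi2_Gamma as E; revert E; unlayer; intros E; exact E.
Qed.

End BraceFacts.

Section BraceCocycle.
Local Open Scope calc_scope.
Variable C : strict_braided.
Variable HH : hopf_brace C.
Notation H := (hb_car HH).

Lemma algebra_module (A : C) (eta : hom K A) (mu : hom (A ⊗ A) A) :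
  is_algebra eta mu -> is_module eta mu mu.
Proof. now intros [E [_ E']]; split. Qed.

Definition regular_brace_module : brace_module HH :=
  @BraceModule C HH HH (hb_mu1 HH) (hb_mu2 HH)
    (algebra_module (proj1 (hb_hopf1 HH)))
    (algebra_module (proj1 (hb_hopf2 HH)))
    (hb_compat HH).

Lemma Gamma_eta1 :
  hb_Gamma HH ∘ (idm H ⊠ hb_eta1 HH) = lun H ∘ (hb_eps HH ⊠ hb_eta1 HH).
Proof.
assert (E : emb (hb_Gamma HH) • layer [H] (emb (hb_eta1 HH)) [] =
  emb (hb_eta1 HH) • emb (hb_eps HH)).
{ apply (@calc_D C H (emb (hb_mu1 HH)) (emb (hb_eta1 HH)) (emb (hb_mu2 HH))
    (emb (hb_eta2 HH)) (emb (hb_eps HH)) (emb (hb_delta HH))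
    (emb (hb_lambda1 HH)) (emb (hb_Gamma HH)));
  auto using typed1, typed01, typed10, typed21, typed12, mul1_unitl, mul1_unitr,
    mul2_unitl, mul2_unitr, antipode_l, delta_unit2, eps_unit2.
  - apply emb_Gamma.
  - exact (emb_Gamma_unit regular_brace_module). }
to_emb.
rewrite (otens_layer (typed10 (hb_eps HH)) (typed01 (hb_eta1 HH))).
pose proof (slide [] [] [] (typed10 (hb_eps HH)) (typed01 (hb_eta1 HH))) as F.
cbn [app] in F; rewrite F, !layer_nil, <- E.
now unlayer.
Qed.

Lemma hb_cocycleP :
  @is_invertible_1cocycle C (hb_H2 HH) (hb_H1 HH) (hb_Gamma HH) (idm H).
Proof.
split; [split; [|split]|split; [|split]].
- exact (Gamma_module regular_brace_module).
- exact Gamma_eta1.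
- exact (Gamma_psi1 regular_brace_module).
- split; simpl; [apply comp_idr|].
  now rewrite tensm_id, comp_idl, comp_idr.
- exists (idm H); simpl; now rewrite comp_idl.
- simpl; rewrite comp_idl; exact (psi2_Gamma regular_brace_module).
Qed.

Definition hb_cocycle : invertible_1cocycle C := Invertible1Cocycle hb_cocycleP.

End BraceCocycle.

(* Main.v *)
Require Import Defs.
From Stdlib Require Import ClassicalEpsilon List.
Import ListNotations.

Set Implicit Arguments.
Unset Strict Implicit.
Unset Printing Implicit Defensive.

(** Over the cocycle [id : H₂ -> H₁] with action [Γ_{H₁}], a module with
    underlying objects [M] and [N] is determined up to isomorphism by the two
    actions on [M]: the [H₁]-action [psi] and the [H₂]-action [phi].  Indeed
    the isomorphism [gamma : N -> M] turns the action on [N] into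
    [psi ∘ (H ⊗ phi) ∘ (δ ⊗ M)] on [M], so [(id, gamma)] is an isomorphism
    onto the module in which [N] is replaced by [M] and [gamma] by the
    identity.

    Cocycle modules and brace modules thus both amount to an [H₁]-action
    [psi] on [M] together with a second action of [H], and the two
    descriptions of the latter are exchanged by the formulas
    [phi |-> psi ∘ (H ⊗ phi) ∘ (δ ⊗ M)] ([twisted_action]) and
    [psi₂ |-> psi ∘ (λ₁ ⊗ psi₂) ∘ (δ ⊗ M)] ([Gamma]).  These are mutually
    inverse because [psi] is an action and [λ₁] is the convolution inverse of
    the identity: one composite is [psi2_Gamma], the other is
    [Gamma_twisted].  From cocycle modules to brace modules, the action axioms
    are carried along [gamma] ([module_transport]), and the brace
    compatibility comes from the rule for moving [psi] through [phi], because
    multiplying [Γ_{H₁}] by a copy of [H] gives [μ²] ([twisted_compat]).  In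
    the other direction the axioms are [Gamma_module] and [Gamma_psi1].

    Both constructions keep the underlying map of a morphism, since [Gamma]
    and [twisted_action] are natural in the module ([Gamma_morph],
    [twisted_morph]).  The comparison isomorphisms are the identity for brace
    modules and [(id, gamma)] for cocycle modules. *)

(** * Categories *)

Lemma is_iso_id (C : category) (A : C) : is_iso (idm A).
Proof. exists (idm A); now rewrite comp_idl. Qed.

Lemma nat_isomorphic_sym (C D : category) (F G : functor C D) :
  nat_isomorphic F G -> nat_isomorphic G F.
Proof.
intros [t [iso_t nat_t]].
assert (exists inv : forall A, hom (G A) (F A),
  forall A, inv A ∘ t A = idm (F A) /\ t A ∘ inv A = idm (G A))
  as [inv inv_t].
{ pose (sig_inv A := constructive_indefinite_description _ (iso_t A)).
  exists (fun A => proj1_sig (sig_inv A)).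
  intros A; exact (proj2_sig (sig_inv A)). }
exists inv; split.
- intros A; exists (t A); destruct (inv_t A); now split.
- intros A B f.
  destruct (inv_t A) as [_ EA], (inv_t B) as [EB _].
  rewrite <- (comp_idr (inv B ∘ fhom G f)), <- EA.
  rewrite <- (comp_assoc (inv B)), (comp_assoc (fhom G f)), <- nat_t.
  now rewrite !comp_assoc, EB, comp_idl.
Qed.

(** * Modules *)

Section Modules.
Variable C : strict_braided.

Lemma lun_nat (M N : C) (f : hom M N) :
  lun N ∘ (idm unit_ob ⊠ f) = f ∘ lun M.
Proof. exact (tensm_unitl f). Qed.

Lemma asc_nat (A A' B B' D D' : C)
    (f : hom A A') (g : hom B B') (h : hom D D') :
  asc A' B' D' ∘ ((f ⊠ g) ⊠ h) = (f ⊠ (g ⊠ h)) ∘ asc A B D.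
Proof. exact (tensm_assoc f g h). Qed.

Lemma tensm_swap (A A' B B' : C) (f : hom A A') (g : hom B B') :
  (f ⊠ idm B') ∘ (idm A ⊠ g) = (idm A' ⊠ g) ∘ (f ⊠ idm B).
Proof. now rewrite <- !tensm_comp, !comp_idl, !comp_idr. Qed.

Lemma module_morph_inv (H M N : C) (phiN : hom (H ⊗ N) N)
    (psi : hom (H ⊗ M) M) (gamma : hom N M) (g : hom M N) :
  g ∘ gamma = idm N -> gamma ∘ g = idm M ->
  is_module_morph phiN psi gamma -> is_module_morph psi phiN g.
Proof.
unfold is_module_morph; intros E1 E2 E.
rewrite <- (comp_idr psi), <- tensm_id, <- E2.
rewrite <- (comp_idl (idm H)), tensm_comp, (comp_assoc psi), <- E.
now rewrite !comp_assoc, E1, !comp_idl.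
Qed.

(** Being invertible, [gamma] exhibits [psi] as the conjugate of [phiN], and
    conjugation preserves the module axioms. *)
Lemma module_transport (H : C) (eta : hom unit_ob H) (mu : hom (H ⊗ H) H)
    (M N : C) (phiN : hom (H ⊗ N) N) (psi : hom (H ⊗ M) M)
    (gamma : hom N M) :
  is_iso gamma -> is_module_morph phiN psi gamma ->
  is_module eta mu phiN -> is_module eta mu psi.
Proof.
intros [g [E1 E2]] Hg [unitN mulN].
pose proof (module_morph_inv E1 E2 Hg) as Hinv; red in Hinv.
assert (Epsi : psi = gamma ∘ (phiN ∘ (idm H ⊠ g)))
  by (now rewrite <- Hinv, comp_assoc, E2, comp_idl).
split.
- rewrite Epsi, <- !comp_assoc, <- tensm_swap, (comp_assoc phiN), unitN.
  now rewrite lun_nat, comp_assoc, E2, comp_idl.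
- transitivity (gamma ∘ (phiN ∘ (idm H ⊠ (phiN ∘ (idm H ⊠ g))) ∘ asc H H M)).
  + rewrite Epsi at 1.
    rewrite <- !comp_assoc, <- tensm_swap, (comp_assoc phiN), mulN.
    rewrite <- tensm_id, <- !comp_assoc, asc_nat.
    f_equal; f_equal; rewrite comp_assoc; f_equal.
    now rewrite <- tensm_comp, comp_idl.
  + rewrite <- Hinv, <- (comp_idl (idm H)) at 1; rewrite tensm_comp.
    rewrite (comp_assoc phiN), <- Hinv, !comp_assoc, E2, comp_idl.
    reflexivity.
Qed.

Lemma Gamma_morph (H : C) (delta : hom H (H ⊗ H)) (lambda1 : hom H H)
    (M M' : C) (psi1 psi2 : hom (H ⊗ M) M) (psi1' psi2' : hom (H ⊗ M') M')
    (f : hom M M') :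
  is_module_morph psi1 psi1' f -> is_module_morph psi2 psi2' f ->
  is_module_morph (Gamma delta lambda1 psi1 psi2)
    (Gamma delta lambda1 psi1' psi2') f.
Proof.
unfold is_module_morph, Gamma; intros E1 E2.
rewrite <- !comp_assoc, tensm_swap, (comp_assoc f), E1.
rewrite <- tensm_id, (comp_assoc (asc _ _ _)), asc_nat, <- !comp_assoc.
f_equal; rewrite !comp_assoc; f_equal; f_equal.
now rewrite <- !tensm_comp, E2, comp_idl, comp_idr.
Qed.

(** Pairs an action [phi] with an [H]-action [psi] along [delta].  For a
    module over a 1-cocycle this is the action that the second module of the
    tuple carries, seen on the first one. *)
Definition twisted_action (H : C) (delta : hom H (H ⊗ H)) (M : C)
    (psi phi : hom (H ⊗ M) M) : hom (H ⊗ M) M :=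
  psi ∘ (idm H ⊠ phi) ∘ asc H H M ∘ (delta ⊠ idm M).

(** [twisted_action] is [Gamma] with the identity in place of the
    antipode. *)
Lemma twisted_morph (H : C) (delta : hom H (H ⊗ H)) (M M' : C)
    (psi phi : hom (H ⊗ M) M) (psi' phi' : hom (H ⊗ M') M') (f : hom M M') :
  is_module_morph psi psi' f -> is_module_morph phi phi' f ->
  is_module_morph (twisted_action delta psi phi)
    (twisted_action delta psi' phi') f.
Proof. exact (@Gamma_morph H delta (idm H) M M' psi phi psi' phi' f). Qed.

End Modules.

(** * The twisted action, diagrammatically *)

(** Here [p1] stands for the [H₁]-action, [G] for the action that is twisted
    by it, and [Q] for the action of the 1-cocycle, [Γ_{H₁}]; the hypothesis
    [Qm2] is then the 1-cocycle condition for the identity. *)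
Section TwistCalculus.
Local Open Scope calc_scope.
Variable C : strict_braided.
Variables H M : C.
Variables m1 u1 m2 e d s c p1 G Q : arr_opt C.
Hypothesis t_m1 : typed m1 [H; H] [H].
Hypothesis t_u1 : typed u1 [] [H].
Hypothesis t_m2 : typed m2 [H; H] [H].
Hypothesis t_e : typed e [H] [].
Hypothesis t_d : typed d [H] [H; H].
Hypothesis t_s : typed s [H] [H].
Hypothesis t_c : typed c [H; H] [H; H].
Hypothesis t_p1 : typed p1 [H; M] [M].
Hypothesis t_G : typed G [H; M] [M].
Hypothesis t_Q : typed Q [H; H] [H].
Notation L := layer.
Hypothesis p1m : p1 • L [] m1 [M] = p1 • L [H] p1 [].
Hypothesis p1u : p1 • L [] u1 [M] = oid [M].
Hypothesis dA : L [] d [H] • d = L [H] d [] • d.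
Hypothesis ed : L [] e [H] • d = oid [H].
Hypothesis sd : m1 • L [] s [H] • d = u1 • e.
Hypothesis Qm2 : m1 • L [H] Q [] • L [] d [H] = m2.
Hypothesis Gp1 : G • L [H] p1 [] =
  p1 • L [] Q [M] • L [H; H] G [] • L [H] c [M] • L [] d [H; M].

(** By coassociativity and associativity of the action, the antipode meets
    the identity of [H], and their convolution product is trivial. *)
Lemma calc_Gamma_twisted :
  p1 • L [] s [M] • L [H] (p1 • L [H] G [] • L [] d [M]) [] • L [] d [M] = G.
Proof.
start.
useb dA [] [M].
exch s p1.
useb p1m [] [].
exch G d.
use sd [] [M].
use p1u [] [].
exch e G.
use ed [] [M].
reflexivity.
Qed.

(** Moving [p1] through [G] produces [Q] next to a copy of [H]; these two
    are merged by [m1 ∘ (H ⊗ Q) ∘ (d ⊗ H) = m2]. *)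
Lemma calc_twisted_compat :
  (p1 • L [H] G [] • L [] d [M]) • L [H] p1 [] =
  p1 • L [] m2 [M] • L [H; H] G [] • L [H] c [M] • L [] d [H; M].
Proof.
rewrite <- Qm2.
start.
exch d p1.
use Gp1 [H] [].
useb p1m [] [].
useb dA [] [H; M].
exch c d.
exch G d.
reflexivity.
Qed.
End TwistCalculus.

(** * The twisted action over a Hopf brace *)

Section BraceTwist.
Local Open Scope calc_scope.
Variable C : strict_braided.
Variable HH : hopf_brace C.
Notation H := (hb_car HH).
Notation L := layer.
Variable M : C.
Variables psi phi : hom (H ⊗ M) M.
Hypothesis psi_module : is_module (hb_eta1 HH) (hb_mu1 HH) psi.
Notation twisted := (twisted_action (hb_delta HH) psi phi).

Lemma emb_twisted_action :
  emb twisted = emb psi • L [H] (emb phi) [] • L [] (emb (hb_delta HH)) [M].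
Proof.
unfold twisted_action, asc; rewrite <- !comp_assoc, emb_comp, emb_comp.
rewrite emb_idto_l, !emb_tens; now unlayer.
Qed.

Lemma emb_module_mul :
  emb psi • L [] (emb (hb_mu1 HH)) [M] = emb psi • L [H] (emb psi) [].
Proof. destruct psi_module as [_ E]; by_emb E. Qed.

Lemma emb_module_unit : emb psi • L [] (emb (hb_eta1 HH)) [M] = oid [M].
Proof. destruct psi_module as [E _]; by_emb E. Qed.

Hint Resolve typed1 typed01 typed10 typed21 typed12 typed22 delta_coassoc
  delta_counit antipode_l emb_module_mul emb_module_unit : twist.

Lemma Gamma_twisted :
  Gamma (hb_delta HH) (hb_lambda1 HH) psi twisted = phi.
Proof.
apply emb_inj; rewrite emb_Gamma, emb_twisted_action.
apply (@calc_Gamma_twisted C H M (emb (hb_mu1 HH)) (emb (hb_eta1 HH))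
  (emb (hb_eps HH))); auto with twist.
Qed.

Hypothesis phi_psi :
  phi ∘ (idm H ⊠ psi) =
  psi ∘ (hb_Gamma HH ⊠ phi) ∘ mid H H H M ∘ (hb_delta HH ⊠ idm (H ⊗ M)).

Lemma twisted_compat :
  brace_compat (hb_delta HH) (hb_lambda1 HH) (hb_mu2 HH) psi twisted.
Proof.
red; rewrite Gamma_twisted.
assert (E : emb phi • L [H] (emb psi) [] =
  emb psi • L [] (emb (hb_Gamma HH)) [M] • L [H; H] (emb phi) [] •
  L [H] (emb (braid H H)) [M] • L [] (emb (hb_delta HH)) [H; M]).
{ pose proof phi_psi as E; to_emb_in E.
  rewrite (otens_layer (typed21 _) (typed21 _)) in E.
  revert E; unlayer; intros E; exact E. }
pose proof (emb_psi2_Gamma (regular_brace_module HH)) as Emu2.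
assert (F : (emb psi • L [H] (emb phi) [] • L [] (emb (hb_delta HH)) [M]) •
  L [H] (emb psi) [] =
  emb psi • L [] (emb (hb_mu2 HH)) [M] • L [H; H] (emb phi) [] •
  L [H] (emb (braid H H)) [M] • L [] (emb (hb_delta HH)) [H; M]).
{ apply (@calc_twisted_compat C H M (emb (hb_mu1 HH)) (emb (hb_mu2 HH))
    (emb (hb_delta HH)) (emb (braid H H)) (emb psi) (emb phi)
    (emb (hb_Gamma HH))); auto with twist. }
unfold twisted_action; to_emb.
rewrite (otens_layer (typed21 (hb_mu2 HH)) (typed21 phi)).
revert F; unlayer; intros F; exact F.
Qed.

End BraceTwist.

(** * The two functors *)

Section Equivalence.
Variable C : strict_braided.
Variable HH : hopf_brace C.
Notation H := (hb_car HH).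
Notation pi := (hb_cocycle HH).

(** The ascriptions identify the carriers of [H₁] and [H₂], which are both
    the object [H]. *)
Definition cm_twisted (X : cocycle_module pi) : hom (H ⊗ cm_M X) (cm_M X) :=
  twisted_action (hb_delta HH) (cm_varphiM X : hom (H ⊗ cm_M X) _)
    (cm_phiM X : hom (H ⊗ cm_M X) _).

Lemma cm_gamma_morph (X : cocycle_module pi) :
  is_module_morph (cm_phiN X : hom (H ⊗ cm_N X) _) (cm_twisted X)
    (cm_gamma X).
Proof.
pose proof (cm_gammaP X) as E; red; unfold cm_twisted, twisted_action.
simpl in *; rewrite E, <- !comp_assoc.
now rewrite <- tensm_comp, comp_idl, comp_idr.
Qed.

Definition brace_of_cocycle (X : cocycle_module pi) : brace_module HH :=
  @BraceModule C HH (cm_M X) (cm_varphiM X) (cm_twisted X)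
    (cm_modMH X)
    (module_transport (cm_gamma_iso X) (cm_gamma_morph X) (cm_modNA X))
    (@twisted_compat C HH (cm_M X) (cm_varphiM X) (cm_phiM X) (cm_modMH X)
      (cm_compat X)).

Definition brace_of_cocycle_hom (X Y : cocycle_module pi)
    (f : cocycle_module_hom X Y) :
  brace_module_hom (brace_of_cocycle X) (brace_of_cocycle Y) :=
  @BraceModuleHom C HH (brace_of_cocycle X) (brace_of_cocycle Y) (cmh_h f)
    (cmh_hH f) (twisted_morph (hb_delta HH) (cmh_hH f) (cmh_hA f)).

Definition brace_of_cocycle_functor :
  functor (cocycle_Mod pi) (brace_Mod HH).
Proof.
refine (@Functor (cocycle_Mod pi) (brace_Mod HH) brace_of_cocycle
  brace_of_cocycle_hom _ _); intros; now apply brace_module_hom_eq.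
Defined.

Definition bm_Gamma (M : brace_module HH) : hom (H ⊗ bm_car M) (bm_car M) :=
  Gamma (hb_delta HH) (hb_lambda1 HH) (bm_psi1 M) (bm_psi2 M).

Lemma bm_Gamma_cocycle (M : brace_module HH) :
  idm (bm_car M) ∘ bm_psi2 M =
  bm_psi1 M ∘ (idm H ⊠ bm_Gamma M) ∘ asc H H (bm_car M)
    ∘ (hb_delta HH ⊠ idm (bm_car M)).
Proof. rewrite comp_idl; exact (psi2_Gamma M). Qed.

Definition cocycle_of_brace (M : brace_module HH) : cocycle_module pi :=
  @CocycleModule C pi (bm_car M) (bm_car M) (bm_Gamma M) (bm_psi1 M)
    (bm_psi2 M) (idm (bm_car M)) (Gamma_module M) (bm_mod1 M) (Gamma_psi1 M)
    (bm_mod2 M) (is_iso_id (bm_car M)) (bm_Gamma_cocycle M).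

Definition cocycle_of_brace_hom (M M' : brace_module HH)
    (f : brace_module_hom M M') :
  cocycle_module_hom (cocycle_of_brace M) (cocycle_of_brace M') :=
  @CocycleModuleHom C pi (cocycle_of_brace M) (cocycle_of_brace M') f f
    (Gamma_morph (hb_delta HH) (hb_lambda1 HH) (bmh_mod1 f) (bmh_mod2 f))
    (bmh_mod1 f) (bmh_mod2 f)
    (eq_trans (comp_idr _) (eq_sym (comp_idl _))).

Definition cocycle_of_brace_functor :
  functor (brace_Mod HH) (cocycle_Mod pi).
Proof.
refine (@Functor (brace_Mod HH) (cocycle_Mod pi) cocycle_of_brace
  cocycle_of_brace_hom _ _); intros; now apply cocycle_module_hom_eq.
Defined.

Lemma brace_module_hom_iso (M M' : brace_Mod HH) (f : hom M M') :
  is_iso (bmh f) -> is_iso f.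
Proof.
intros [g [E1 E2]].
exists (BraceModuleHom (module_morph_inv E1 E2 (bmh_mod1 f))
  (module_morph_inv E1 E2 (bmh_mod2 f))).
split; now apply brace_module_hom_eq.
Qed.

Lemma cocycle_module_hom_iso (X Y : cocycle_Mod pi) (f : hom X Y) :
  is_iso (cmh_h f) -> is_iso (cmh_l f) -> is_iso f.
Proof.
intros [h [Eh1 Eh2]] [l [El1 El2]].
assert (E : h ∘ cm_gamma Y = cm_gamma X ∘ l).
{ rewrite <- (comp_idr (h ∘ cm_gamma Y)), <- El2, !comp_assoc.
  rewrite <- (comp_assoc h), <- cmh_gamma, comp_assoc, Eh1.
  now rewrite comp_idl. }
exists (CocycleModuleHom (module_morph_inv Eh1 Eh2 (cmh_hA f))
  (module_morph_inv Eh1 Eh2 (cmh_hH f)) (module_morph_inv El1 El2 (cmh_lA f))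
  E).
split; now apply cocycle_module_hom_eq.
Qed.

Lemma brace_roundtrip :
  nat_isomorphic
    (functor_comp brace_of_cocycle_functor cocycle_of_brace_functor)
    (functor_id (brace_Mod HH)).
Proof.
assert (Epsi2 : forall M : brace_module HH,
  is_module_morph (cm_twisted (cocycle_of_brace M)) (bm_psi2 M)
    (idm (bm_car M))).
{ intros M; red; rewrite tensm_id, comp_idl, comp_idr.
  symmetry; exact (psi2_Gamma M). }
exists (fun M => @BraceModuleHom C HH (brace_of_cocycle (cocycle_of_brace M))
  M (idm _) (module_morph_id _) (Epsi2 M)).
split.
- intros M; apply brace_module_hom_iso, is_iso_id.
- intros M M' f; apply brace_module_hom_eq; simpl.
  now rewrite comp_idl, comp_idr.
Qed.

(** The comparison is written in the direction in which its second component
    is [cm_gamma X] rather than the inverse of it. *)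
Lemma cocycle_roundtrip :
  nat_isomorphic (functor_id (cocycle_Mod pi))
    (functor_comp cocycle_of_brace_functor brace_of_cocycle_functor).
Proof.
assert (EGamma : forall X : cocycle_module pi,
  is_module_morph (cm_phiM X : hom (H ⊗ cm_M X) _)
    (bm_Gamma (brace_of_cocycle X)) (idm (cm_M X))).
{ intros X; red; rewrite tensm_id, comp_idl, comp_idr.
  symmetry; apply Gamma_twisted; exact (cm_modMH X). }
exists (fun X => @CocycleModuleHom C pi X
  (cocycle_of_brace (brace_of_cocycle X)) (idm _) (cm_gamma X) (EGamma X)
  (module_morph_id _) (cm_gamma_morph X) eq_refl).
split.
- intros X; apply cocycle_module_hom_iso.
  + apply is_iso_id.
  + exact (cm_gamma_iso X).
- intros X Y f; apply cocycle_module_hom_eq; simpl.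
  + now rewrite comp_idl, comp_idr.
  + symmetry; apply cmh_gamma.
Qed.

End Equivalence.

Theorem corollary2p27 (C : strict_braided) (HH : hopf_brace C) :
  equivalent (cocycle_Mod (hb_cocycle HH)) (brace_Mod HH).
Proof.
exists (brace_of_cocycle_functor HH), (cocycle_of_brace_functor HH); split.
- apply nat_isomorphic_sym, cocycle_roundtrip.
- apply brace_roundtrip.
Qed.
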